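(* For every history-deterministic one-counter net $\mathcal{N}$ there exists a deterministic one-counter automaton $\mathcal{D}$ with $\mathcal{L}(\mathcal{D})=\mathcal{L}(\mathcal{N})$.
   Context: A one-counter net (OCN) is $\mathcal{N}=(Q,\Sigma,\Delta,q_0,F)$ with $Q$ finite, $\Sigma$ finite, $q_0\in Q$, $F\subseteq Q$, $\Delta\subseteq Q\times\Sigma\times\{-1,0,1\}\times Q$; configurations $(q,n)\in Q\times\mathbb{N}$, step $(q,n)\xrightarrow{a,d}(p,n+d)$ if $(q,a,d,p)\in\Delta$ and $n+d\ge0$; runs start at $(q_0,0)$ and are accepting if the last state is in $F$; $\mathcal{L}(\mathcal{N})$ is the set of words with an accepting run. Letter game: positions $(c,w)$, start $((q_0,0),\varepsilon)$; each round Adam picks $a\in\Sigma$, Eve picks a step $c\xrightarrow{a,d}c'$; if Eve has none and $wa$ is a prefix of a word of $\mathcal{L}(\mathcal{N})$ she loses; if $wa\in\mathcal{L}(\mathcal{N})$ but the state of $c'$ is not in $F$, Adam wins; otherwise continue from $(c',wa)$; Eve wins infinite plays. $\mathcal{N}$ is history-deterministic if Eve wins the letter game. A one-counter automaton (OCA) is $(Q,\Sigma,\Delta,q_0,F)$ with $\Delta\subseteq Q\times\{\mathrm{zero},\neg\mathrm{zero}\}\times\Sigma\times\{-1,0,1\}\times Q$, where $\mathrm{zero}$-transitions may be taken only when the counter is $0$ (with update in $\{0,1\}$) and $\neg\mathrm{zero}$-transitions only when it is positive; runs, acceptance and language as for OCNs. It is deterministic if $\Delta$ is a partial function from $Q\times\{\mathrm{zero},\neg\mathrm{zero}\}\times\Sigma$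 to $\{-1,0,1\}\times Q$. *)

(* Defs.v *)
From mathcomp Require Import all_boot all_order all_algebra.
Set Implicit Arguments. Unset Strict Implicit. Unset Printing Implicit Defensive.
Import GRing.Theory Num.Theory.
Local Open Scope ring_scope.

Definition is_update (d : int) : bool := (d == -1) || (d == 0) || (d == 1).

Record OCN (Sigma : finType) := {
  ocn_Q : finType;
  ocn_delta : ocn_Q -> Sigma -> int -> ocn_Q -> bool;
  ocn_q0 : ocn_Q;
  ocn_F : {set ocn_Q} }.
Arguments ocn_Q {Sigma} _.
Arguments ocn_delta {Sigma} _ _ _ _ _.
Arguments ocn_q0 {Sigma} _.
Arguments ocn_F {Sigma} _.

Definition OCN_wf Sigma (N : OCN Sigma) : Prop :=
  forall q a d p, ocn_delta N q a d p -> is_update d.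

Definition ocn_step Sigma (N : OCN Sigma) (c : ocn_Q N * nat) (a : Sigma)
  (c' : ocn_Q N * nat) : Prop :=
  exists d : int, ocn_delta N c.1 a d c'.1 /\ (c.2%:Z + d = c'.2%:Z).

Arguments ocn_step {Sigma} N _ _ _.

Inductive ocn_run Sigma (N : OCN Sigma) :
  ocn_Q N * nat -> seq Sigma -> ocn_Q N * nat -> Prop :=
| ocn_run_nil c : @ocn_run Sigma N c [::] c
| ocn_run_cons c a c' w c'' :
    @ocn_step Sigma N c a c' -> @ocn_run Sigma N c' w c'' -> @ocn_run Sigma N c (a :: w) c''.
Arguments ocn_run {Sigma} N _ _ _.

Definition ocn_lang Sigma (N : OCN Sigma) (w : seq Sigma) : Prop :=
  exists c, ocn_run N (ocn_q0 N, 0%N) w c /\ c.1 \in ocn_F N.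

Definition is_prefix_of_lang Sigma (L : seq Sigma -> Prop) (w : seq Sigma) : Prop :=
  exists v, L (w ++ v).

(* ---------- Letter game ----------
   Since Adam's moves are letters and Eve's strategy is deterministic, the play
   history is determined by the word read so far; an Eve strategy maps the word
   read so far w and Adam's next letter a to a proposed step (d, p), meaning the
   step c --a,d--> (p, n+d). *)
Definition eve_strategy Sigma (N : OCN Sigma) := seq Sigma -> Sigma -> int * ocn_Q N.

Definition valid_move Sigma (N : OCN Sigma) (c : ocn_Q N * nat) (a : Sigma)
  (m : int * ocn_Q N) : bool :=
  ocn_delta N c.1 a m.1 m.2 && (0 <= c.2%:Z + m.1).

Definition apply_move Sigma (N : OCN Sigma) (c : ocn_Q N * nat) (a : Sigma)
  (m : int * ocn_Q N) : option (ocn_Q N * nat) :=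
  if valid_move c a m then Some (m.2, absz (c.2%:Z + m.1)) else None.

Arguments valid_move {Sigma N} _ _ _.
Arguments apply_move {Sigma N} _ _ _.

Fixpoint play_from Sigma (N : OCN Sigma) (sigma : eve_strategy N) (h : seq Sigma)
  (oc : option (ocn_Q N * nat)) (w : seq Sigma) : option (ocn_Q N * nat) :=
  match w with
  | [::] => oc
  | a :: w' =>
      let oc' := match oc with Some c => apply_move c a (sigma h a) | None => None end in
      play_from sigma (rcons h a) oc' w'
  end.

Definition play Sigma (N : OCN Sigma) (sigma : eve_strategy N) (w : seq Sigma) :=
  play_from sigma [::] (Some (ocn_q0 N, 0%N)) w.

(* sigma is winning: whenever the play is still going on at (c, w) and Adam plays a,
   - if w a is a prefix of a word of L(N), Eve's move is a legal step
     (otherwise she loses), and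
   - if w a \in L(N), the state reached is final (otherwise Adam wins).
   Plays in which neither ever happens (in particular infinite ones) are won by Eve. *)
Definition eve_winning Sigma (N : OCN Sigma) (sigma : eve_strategy N) : Prop :=
  forall (w : seq Sigma) (a : Sigma) (c : ocn_Q N * nat),
    play sigma w = Some c ->
    is_prefix_of_lang (@ocn_lang Sigma N) (rcons w a) ->
    valid_move c a (sigma w a) /\
    (ocn_lang N (rcons w a) -> (sigma w a).2 \in ocn_F N).

Definition history_deterministic Sigma (N : OCN Sigma) : Prop :=
  exists sigma : eve_strategy N, eve_winning sigma.

Record OCA (Sigma : finType) := {
  oca_Q : finType;
  (* oca_delta q z a d p : (q, t, a, d, p) \in Delta, where t = zero iff z = true *)
  oca_delta : oca_Q -> bool -> Sigma -> int -> oca_Q -> bool;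
  oca_q0 : oca_Q;
  oca_F : {set oca_Q} }.
Arguments oca_Q {Sigma} _.
Arguments oca_delta {Sigma} _ _ _ _ _ _.
Arguments oca_q0 {Sigma} _.
Arguments oca_F {Sigma} _.

Definition OCA_wf Sigma (A : OCA Sigma) : Prop :=
  forall q z a d p, oca_delta A q z a d p ->
    is_update d /\ (z -> (d == 0) || (d == 1)).

Definition OCA_deterministic Sigma (A : OCA Sigma) : Prop :=
  forall q z a d p d' p', oca_delta A q z a d p -> oca_delta A q z a d' p' ->
    d = d' /\ p = p'.

Definition oca_step Sigma (A : OCA Sigma) (c : oca_Q A * nat) (a : Sigma)
  (c' : oca_Q A * nat) : Prop :=
  exists d : int, oca_delta A c.1 (c.2 == 0%N) a d c'.1 /\ (c.2%:Z + d = c'.2%:Z).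

Arguments oca_step {Sigma} A _ _ _.

Inductive oca_run Sigma (A : OCA Sigma) :
  oca_Q A * nat -> seq Sigma -> oca_Q A * nat -> Prop :=
| oca_run_nil c : @oca_run Sigma A c [::] c
| oca_run_cons c a c' w c'' :
    @oca_step Sigma A c a c' -> @oca_run Sigma A c' w c'' -> @oca_run Sigma A c (a :: w) c''.
Arguments oca_run {Sigma} A _ _ _.

Definition oca_lang Sigma (A : OCA Sigma) (w : seq Sigma) : Prop :=
  exists c, oca_run A (oca_q0 A, 0%N) w c /\ c.1 \in oca_F A.

(* Main.v *)
Require Import Defs.
From mathcomp Require Import all_boot all_order all_algebra.
From mathcomp Require Import boolp zify.

(** The relevant order on configurations is the simulation preorder: a net,
    completed by a rejecting sink, is history-deterministic only if for every
    word one of the reached configurations simulates all the others. Eve can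
    then follow any successor that simulates all successors of her current
    configuration on the same letter, and which successors have this property
    at counter value [n] only depends on the pairs [(p, m)], [(q, n')] with
    [m] and [n'] close to [n]. It remains to see that this near-diagonal part
    of the preorder is eventually periodic in [n]; the deterministic automaton
    then stores [n] up to a threshold and modulo the period.

    Periodicity rests on a belt theorem for slope 1: for every pair of states
    [(p, q)] the frontier [max {m | (p, m) is simulated by (q, n)}] either stays
    at bounded distance from [n], or its difference with [n] tends to +oo or to
    -oo. It is obtained by lowering a slope from +oo through the multiples of
    [1 / D], where [D] is divisible by every possible effect of a cycle of pairs
    on the counter: at each slope, a game that ends when a pair of states
    repeats decides, according to the weight of that cycle, who wins far away
    from the line of that slope. Finally two levels with the same near-diagonal
    relation are found by pigeonhole, and copying strategies between them shows
    that all levels above repeat with that period. *)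

Set Implicit Arguments. Unset Strict Implicit. Unset Printing Implicit Defensive.
Import Order.TTheory GRing.Theory Num.Theory.
Local Open Scope ring_scope.

(** * Simulation and the cycle game on pairs of states *)

Section Simulation.
Variables (Sigma : finType) (N : OCN Sigma).
Local Notation config := (ocn_Q N * nat)%type.

Definition is_simulation (R : config -> config -> Prop) : Prop :=
  forall c c', R c c' ->
    (c.1 \in ocn_F N -> c'.1 \in ocn_F N) /\
    forall a c1, ocn_step N c a c1 -> exists2 c1', ocn_step N c' a c1' & R c1 c1'.

Definition simulated (c c' : config) : Prop := exists2 R, is_simulation R & R c c'.

Lemma simulated_is_simulation : is_simulation simulated.
Proof.
move=> c c' [R simR Rcc']; have [accR stepR] := simR _ _ Rcc'; split=> // a c1 st.
by have [c1' st' R1] := stepR _ _ st; exists c1' => //; exists R.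
Qed.

Lemma simulated_final c c' : simulated c c' -> c.1 \in ocn_F N -> c'.1 \in ocn_F N.
Proof. by case/simulated_is_simulation. Qed.

Lemma simulated_step c c' a c1 :
  simulated c c' -> ocn_step N c a c1 -> exists2 c1', ocn_step N c' a c1' & simulated c1 c1'.
Proof. by case/simulated_is_simulation=> _ h /h. Qed.

(** Duplicator may leave [R] for a known simulation; the assumption [~ simulated c c'] disposes of
    boundary cases in later uses. *)
Lemma simulation_up_to (R : config -> config -> Prop) :
  (forall c c', R c c' -> ~ simulated c c' ->
    (c.1 \in ocn_F N -> c'.1 \in ocn_F N) /\
    forall a c1, ocn_step N c a c1 ->
      exists2 c1', ocn_step N c' a c1' & R c1 c1' \/ simulated c1 c1') ->
  forall c c', R c c' -> simulated c c'.
Proof.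
move=> hR c c' Rcc'; exists (fun c c' => R c c' \/ simulated c c'); last by left.
move=> {Rcc'}{}c {}c' Rcc'.
have [scc'|nscc'] := pselect (simulated c c').
  split; first exact: simulated_final.
  move=> a c1 /(simulated_step scc')[c1' st s1]; by exists c1' => //; right.
by case: Rcc' => // /hR; apply.
Qed.

Lemma simulated_refl c : simulated c c.
Proof.
by exists eq => // {}c _ <-; split=> // a c1 st; exists c1.
Qed.

Lemma simulated_trans c2 c1 c3 : simulated c1 c2 -> simulated c2 c3 -> simulated c1 c3.
Proof.
move=> s12 s23; exists (fun c c' => exists2 d, simulated c d & simulated d c'); last by exists c2.
move=> c c' [d scd sdc']; split=> [/(simulated_final scd)/(simulated_final sdc') //|a e].
move=> /(simulated_step scd)[d1 /(simulated_step sdc')[e1 st1 s1] s2].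
by exists e1 => //; exists d1.
Qed.

(** Nets cannot test for zero: a move enabled at some counter value is enabled at all larger
    ones. *)
Lemma simulated_mono p q (m m' n n' : nat) :
  (m' <= m)%N -> (n <= n')%N -> simulated (p, m) (q, n) -> simulated (p, m') (q, n').
Proof.
move=> lem len s.
exists (fun c c' => exists i j : nat, [/\ (c.2 <= i)%N, (j <= c'.2)%N &
  simulated (c.1, i) (c'.1, j)]); last by exists m, n.
move=> [p1 m1] [q1 n1] [i [j [/= lei lej s1]]]; split; first exact: (simulated_final s1).
move=> a [p2 m2] [d [/= dl eq]].
have st : ocn_step N (p1, i) a (p2, absz (i%:Z + d)) by exists d; split=> //=; lia.
have [[q2 j2] [d' [/= dl' eq']] s2] := simulated_step s1 st.
exists (q2, absz (n1%:Z + d')); first by exists d'; split=> //=; lia.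
by exists (absz (i%:Z + d)), j2; split=> //=; lia.
Qed.

(* A pair of states with the effects accumulated by Spoiler and Duplicator, in this order. *)
Definition pair_effect := (ocn_Q N * ocn_Q N * (int * int))%type.

(** The change of [b * m - a * n], the height over the line, under effects [e] on [m] and [n]. *)
Definition line_weight (a b : nat) (e : int * int) : int := b%:Z * e.1 - a%:Z * e.2.

(* The game on pairs of states ends when a pair repeats; Spoiler wants the cycle to lie above
   the line of slope [a / b] ([b = 0] is slope +oo) and must stay in [V] until then. The first
   argument is the history of visited pairs, most recent first. *)
Inductive spoiler_wins (V : ocn_Q N * ocn_Q N -> Prop) (a b : nat) :
  seq pair_effect -> ocn_Q N * ocn_Q N -> int * int -> Prop :=
| spoiler_wins_final h x e :
    x.1 \in ocn_F N -> x.2 \notin ocn_F N -> spoiler_wins V a b h x e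
| spoiler_wins_cycle h x e e0 :
    (x, e0) \in h -> line_weight a b e0 < line_weight a b e -> spoiler_wins V a b h x e
| spoiler_wins_move h x e l d p :
    V x -> x \notin unzip1 h -> ocn_delta N x.1 l d p ->
    (forall d' q, ocn_delta N x.2 l d' q ->
       spoiler_wins V a b ((x, e) :: h) (p, q) (e.1 + d, e.2 + d')) ->
    spoiler_wins V a b h x e.

Definition cycle_free_position
    (P : seq pair_effect -> ocn_Q N * ocn_Q N -> int * int -> Prop)
    (V : ocn_Q N * ocn_Q N -> Prop) h x (e : int * int) : Prop :=
  [/\ P h x e, V x, x \notin unzip1 h,
      `|e.1| <= (size h)%:Z & `|e.2| <= (size h)%:Z].

(* When a cycle is closed in the simulation game, it is cut out and the play resumes from the
   earlier occurrence of the pair; hence [P] has to hold at every entry of the history. *)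
Fixpoint cycle_free_history
    (P : seq pair_effect -> ocn_Q N * ocn_Q N -> int * int -> Prop)
    (V : ocn_Q N * ocn_Q N -> Prop) (h : seq pair_effect) : Prop :=
  if h is (x, e) :: t then cycle_free_position P V t x e /\ cycle_free_history P V t
  else True.

Lemma cycle_free_history_mem P V h x e : cycle_free_history P V h -> (x, e) \in h ->
  exists2 t, cycle_free_position P V t x e & cycle_free_history P V t.
Proof.
elim: h => //= -[y f] t IH [pos hist]; rewrite inE => /orP[/eqP[-> ->]|]; last exact: IH.
by exists t.
Qed.

Local Notation npairs := #|{: ocn_Q N * ocn_Q N}|.

Lemma cycle_free_history_size P V h : cycle_free_history P V h -> (size h <= npairs)%N.
Proof.
move=> hist; rewrite -(size_map fst); apply: (@leq_trans #|unzip1 h|); last exact: max_card.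
rewrite (card_uniqP _) //; elim: h hist => //= -[y f] t IH [[_ _ nin _ _] hist].
by rewrite nin /= IH.
Qed.

Lemma line_weight_bound a b (e : int * int) (k : nat) : `|e.1| <= k%:Z -> `|e.2| <= k%:Z ->
  `|line_weight a b e| <= (((a + b) * k)%N)%:Z.
Proof. rewrite /line_weight; case: e => e1 e2 /=; nia. Qed.

Hypothesis wfN : OCN_wf N.

Lemma delta_bound q a d p : ocn_delta N q a d p -> -1 <= d <= 1.
Proof. by move/wfN; rewrite /is_update; lia. Qed.

(** Spoiler follows the cycle game. Cutting out a closed cycle keeps the counters but lowers the
    weight of [e] for slope [a / b] by at least 1, without raising it for [a' / b']. After finitely
    many cycles the position is above the line of slope [a / b], where Spoiler wins from [V]. *)
Lemma spoiler_wins_above (V : ocn_Q N * ocn_Q N -> Prop) (a b a' b' c : nat) :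
  (0 < b')%N ->
  (forall p q m n, V (p, q) -> (a * n + c <= b * m)%N -> ~ simulated (p, m) (q, n)) ->
  (forall e : int * int, `|e.1| <= (2 * npairs)%:Z -> `|e.2| <= (2 * npairs)%:Z ->
     0 < line_weight a b e -> 0 <= line_weight a' b' e) ->
  exists c' : nat, forall p q m n, spoiler_wins V a b [::] (p, q) (0, 0) ->
    (a' * n + c' <= b' * m)%N -> ~ simulated (p, m) (q, n).
Proof.
move=> b'_gt0 aboveV cyc.
set C := ((a + b) * npairs)%N; set C' := ((a' + b') * npairs)%N.
(* [z] bounds the height still missing over the line [a / b]. [C] and [C'] absorb the weight of [e];
   the extra [b'] keeps [m] positive, so that Spoiler's moves are enabled. *)
suff key (z : nat) h x e : spoiler_wins V a b h x e -> forall m n : nat,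
    cycle_free_history (spoiler_wins V a b) V h ->
    `|e.1| <= (size h)%:Z -> `|e.2| <= (size h)%:Z ->
    a'%:Z * n%:Z + (b' + C')%:Z + line_weight a' b' e <= b'%:Z * m%:Z ->
    a%:Z * n%:Z + (c + C)%:Z + line_weight a b e - b%:Z * m%:Z <= z%:Z ->
    ~ simulated (x.1, m) (x.2, n).
  exists (b' + C')%N => p q m n win above.
  apply: (key (a * n + c + C)%N _ _ _ win) => //=; rewrite /line_weight /=; nia.
elim: z h x e => [|z IHz] h x e.
  move=> win m n hist e1 e2 _ small sim; have szh := cycle_free_history_size hist.
  have wb : `|line_weight a b e| <= C%:Z by apply: line_weight_bound; lia.
  have V_or_final : V x \/ (x.1 \in ocn_F N /\ x.2 \notin ocn_F N).
    case: win hist {e1 e2 small wb szh sim} => {}h {}x {}e; first by right.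
      move=> e0 xh _ hist; left.
      by have [t [_ Vx _ _ _] _] := cycle_free_history_mem hist xh.
    by left.
  case: V_or_final => [Vx|[F1 /negP F2]]; last by apply: F2; exact: (simulated_final sim).
  case: x Vx sim {win} => p q Vx sim; apply: aboveV Vx _ sim; move: small wb; lia.
elim=> {}h {}x {}e.
- by move=> F1 /negP F2 m n _ _ _ _ _ sim; apply: F2; exact: (simulated_final sim).
- move=> e0 xh gain m n hist e1 e2 up small.
  have szh := cycle_free_history_size hist.
  have [t [win0 _ nint e01 e02] histt] := cycle_free_history_mem hist xh.
  have szt := cycle_free_history_size histt.
  have := cyc (e.1 - e0.1, e.2 - e0.2); rewrite /line_weight /= in gain up small * => cyc0.
  apply: (IHz t x e0 win0) => //; rewrite /line_weight; nia.
- move=> l d p Vx nin dl wins IH m n hist e1 e2 up small sim.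
  have win := spoiler_wins_move Vx nin dl wins.
  have szh := cycle_free_history_size hist.
  have wb : `|line_weight a' b' e| <= C'%:Z by apply: line_weight_bound; lia.
  have m_gt0 : (0 < m)%N by nia.
  have db := delta_bound dl.
  have st : ocn_step N (x.1, m) l (p, absz (m%:Z + d)) by exists d; split=> //=; lia.
  have [[q n'] [d' [/= dl' eq']] sim'] := simulated_step sim st.
  have db' := delta_bound dl'.
  apply: (IH d' q dl' (absz (m%:Z + d)) n' _ _ _ _ _ sim') => //=;
    by rewrite /line_weight /= in up small *; nia.
Qed.
End Simulation.

(** * The belt theorem, by descending slopes *)

Section Belt.
Variables (Sigma : finType) (N : OCN Sigma).
Local Notation npairs := #|{: ocn_Q N * ocn_Q N}|.
Hypothesis wfN : OCN_wf N.

(** Duplicator keeps Spoiler from winning the cycle game. The inequality in [R] concerns the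
    counters minus the effects [e], so cutting out a cycle of weight at most 0 preserves it. Outside
    [V], [belowV] takes over. *)
Lemma duplicator_wins_below (V : ocn_Q N * ocn_Q N -> Prop) (a b c : nat) :
  (0 < a)%N ->
  (forall p q m n, ~ V (p, q) -> (b * m + c <= a * n)%N -> simulated (p, m) (q, n)) ->
  exists c' : nat, forall p q m n, ~ spoiler_wins V a b [::] (p, q) (0, 0) ->
    (b * m + c' <= a * n)%N -> simulated (p, m) (q, n).
Proof.
(* [npairs.+1] since effects are also measured right after a move, before any cut. The summand [a]
   added below keeps Duplicator's counter positive. *)
move=> a_gt0 belowV; set C := ((a + b) * npairs.+1)%N.
pose lose h x e := ~ spoiler_wins V a b h x e.
pose R (x y : ocn_Q N * nat) := exists h e,
  [/\ cycle_free_position lose V h (x.1, y.1) e, cycle_free_history lose V h &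
      b%:Z * x.2%:Z + (a + c + C)%:Z <= a%:Z * y.2%:Z + line_weight a b e].
exists (a + c + C)%N => p q m n nwin below.
have [Vpq|nVpq] := pselect (V (p, q)); last by apply: belowV => //; lia.
have : R (p, m) (q, n).
  by exists [::], (0, 0); split=> //=; rewrite /line_weight /=; nia.
apply: simulation_up_to => {p q m n nwin below Vpq} -[p m] [q n] [h [e [pos hist below]]] _.
case: (pos) => /= nwin Vpq nin e1 e2 /= in below *.
have szh := cycle_free_history_size hist.
have wb : `|line_weight a b e| <= ((a + b) * npairs)%:Z by apply: line_weight_bound; lia.
have Cle : ((a + b) * npairs <= C)%N by rewrite leq_mul2l leqnSn orbT.
have n_gt0 : (0 < n)%N by move: wb below; rewrite -/C; nia.
split=> [F1|l [p' m'] [d [/= dl eqm]]].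
  by apply/negPn/negP => F2; apply: nwin; exact: spoiler_wins_final.
have [d' [q' [dl' nwin']]] : exists d' q', ocn_delta N q l d' q' /\
    ~ spoiler_wins V a b (((p, q), e) :: h) (p', q') (e.1 + d, e.2 + d').
  apply: contrapT => no; apply: nwin; apply: (spoiler_wins_move Vpq nin dl) => d' q' dl'.
  by apply: contrapT => nwin'; apply: no; exists d', q'.
have [db db'] := (delta_bound wfN dl, delta_bound wfN dl').
exists (q', absz (n%:Z + d')); first by exists d'; split=> //=; lia.
set e' := (e.1 + d, e.2 + d') in nwin'.
have hist' : cycle_free_history lose V (((p, q), e) :: h) by split.
have [e1' e2'] : `|e'.1| <= (size h).+1%:Z /\ `|e'.2| <= (size h).+1%:Z by rewrite /e' /=; lia.
have below' : b%:Z * m'%:Z + (a + c + C)%:Z <= a%:Z * (absz (n%:Z + d'))%:Z + line_weight a b e'.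
  have -> : (absz (n%:Z + d'))%:Z = n%:Z + d' by lia.
  move: below; rewrite -eqm /line_weight /e' /=; lia.
have [Vpq'|nVpq'] := pselect (V (p', q')); last first.
  right; apply: belowV => //.
  have wb' : `|line_weight a b e'| <= C%:Z.
    by apply: line_weight_bound; [apply: le_trans e1' _|apply: le_trans e2' _]; lia.
  move: wb' below'; lia.
left; have [/mapP[[x e0] /= xin eqx]|nin'] := boolP ((p', q') \in unzip1 (((p, q), e) :: h)).
  rewrite -eqx in xin; have [t pos0 histt] := cycle_free_history_mem hist' xin.
  exists t, e0; split=> //=.
  apply: le_trans below' _; rewrite lerD2l leNgt; apply/negP => gain.
  by apply: nwin'; apply: spoiler_wins_cycle gain.
by exists (((p, q), e) :: h), e'; split.
Qed.

(* The slopes [i / slope_den] include every ratio of effects of a cycle of pairs. *)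
Definition slope_den : nat := (2 * npairs)`!.

Lemma slope_den_gt0 : (0 < slope_den)%N. Proof. exact: fact_gt0. Qed.

(** Up to constants, no frontier runs strictly between the slopes [i / slope_den] and
    [i.+1 / slope_den]. *)
Definition belt_split (i : nat) : Prop := exists (V : ocn_Q N * ocn_Q N -> Prop) (c : nat),
  (forall p q m n, V (p, q) -> (i * n + c <= slope_den * m)%N -> ~ simulated (p, m) (q, n)) /\
  (forall p q m n, ~ V (p, q) -> (slope_den * m + c <= i.+1 * n)%N -> simulated (p, m) (q, n)).

Lemma belt_split_of_bounds (V : ocn_Q N * ocn_Q N -> Prop) i c c' :
  (forall p q m n, V (p, q) -> (i * n + c <= slope_den * m)%N -> ~ simulated (p, m) (q, n)) ->
  (forall p q m n, ~ V (p, q) -> (slope_den * m + c' <= i.+1 * n)%N -> simulated (p, m) (q, n)) ->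
  belt_split i.
Proof.
move=> above below; exists V, (c + c')%N.
by split=> p q m n Vpq le; [apply: above Vpq _|apply: below Vpq _]; lia.
Qed.

(** At slope +oo Spoiler seeks cycles that decrease Duplicator's counter; as they cost him at most
    [2 * npairs], their weight at slope [2 * npairs] is nonnegative. If he fails, Duplicator wins
    from every large [n], whatever [m]. *)
Lemma belt_split_top : belt_split (slope_den * (2 * npairs)).
Proof.
have D_gt0 := slope_den_gt0.
have [|//|c above] := @spoiler_wins_above _ _ wfN (fun=> True) 1 0
    (slope_den * (2 * npairs)) slope_den 1 D_gt0.
- by move=> p q m n _; lia.
- case=> e d /=; rewrite /line_weight /= => eb db d_lt0.
  have : 0 <= slope_den%:Z * (e - (2 * npairs)%:Z * d) by apply: mulr_ge0 => //; nia.
  by lia.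
have [//|c' below] := @duplicator_wins_below (fun=> True) 1 0 0 isT.
apply: (@belt_split_of_bounds (fun x => spoiler_wins (fun=> True) 1 0 [::] x (0, 0)) _ c
  ((slope_den * (2 * npairs)).+1 * c')%N) => // p q m n nwin le.
apply: below => //; nia.
Qed.

Lemma belt_split_pred i : belt_split i.+1 -> belt_split i.
Proof.
have D_gt0 := slope_den_gt0.
move=> [V [c [aboveV belowV]]].
have [//||c1 above] := @spoiler_wins_above _ _ wfN V i.+1 slope_den i slope_den c D_gt0.
- case=> e d /=; rewrite /line_weight /= => eb db.
  have [d_ge0|d_lt0] := lerP 0 d; first by lia.
  (* As [- d] divides [slope_den], it can be factored out of both weights; what remains are
     consecutive integers, so positivity of the larger makes the smaller nonnegative. *)
  have /dvdnP[k eqk] : (absz d %| slope_den)%N by rewrite dvdn_fact //; lia.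
  have eqD : slope_den%:Z = k%:Z * - d by lia.
  have -> : slope_den%:Z * e - i.+1%:Z * d = - d * (k%:Z * e + i.+1%:Z) by rewrite eqD; lia.
  have -> : slope_den%:Z * e - i%:Z * d = - d * (k%:Z * e + i%:Z) by rewrite eqD; lia.
  by rewrite pmulr_rgt0 ?pmulr_rge0; lia.
have [p q m n nV le|c2 below] := @duplicator_wins_below V i.+1 slope_den c isT.
  by apply: belowV nV _; lia.
exact: (@belt_split_of_bounds (fun x => spoiler_wins V i.+1 slope_den [::] x (0, 0)) _ c1 c2).
Qed.

Lemma belt_splitP i : (i <= slope_den * (2 * npairs))%N -> belt_split i.
Proof.
move=> le; move: belt_split_top; move: (slope_den * _)%N le => t /subnKC <-.
by elim: (t - i)%N => [|k IH]; rewrite ?addn0 // addnS => /belt_split_pred.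
Qed.
End Belt.

(** * Periodicity of the preorder near the diagonal *)

Section Periodicity.
Variables (Sigma : finType) (N : OCN Sigma).
Local Notation npairs := #|{: ocn_Q N * ocn_Q N}|.
Hypothesis wfN : OCN_wf N.

(** One round changes the difference of the counters by at most 2; the margins 2 here and 3 in
    [frontier_below_band] decide any pair of these kinds reached from the band. *)
Definition frontier_above_band (K n0 : nat) (p q : ocn_Q N) : Prop :=
  forall n, (n0 <= n)%N -> simulated (p, n + K + 2)%N (q, n).

Definition frontier_in_band (K n0 : nat) (p q : ocn_Q N) : Prop :=
  forall n, (n0 <= n)%N -> simulated (p, n - K)%N (q, n) /\ ~ simulated (p, n + K + 1)%N (q, n).

Definition frontier_below_band (K n0 : nat) (p q : ocn_Q N) : Prop :=
  forall n, (n0 <= n)%N -> ~ simulated (p, n - (K + 3))%N (q, n).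

Lemma diagonal_trichotomy : exists K n0 : nat, (K + 3 <= n0)%N /\ forall p q : ocn_Q N,
  [\/ frontier_above_band K n0 p q, frontier_in_band K n0 p q | frontier_below_band K n0 p q].
Proof.
have np_gt0 : (0 < npairs)%N by apply/card_gt0P; exists (ocn_q0 N, ocn_q0 N).
have D_gt0 := slope_den_gt0 N; set D := slope_den N in D_gt0.
have leD : (D <= D * (2 * npairs))%N by nia.
(* The splits at [D] and [D.-1] isolate the frontiers of slope exactly 1. *)
have [V1 [c1 [above1 below1]]] := belt_splitP wfN leD.
have [V2 [c2 [above2 below2]]] := belt_splitP wfN (leq_trans (leq_pred D) leD).
rewrite -/D prednK // in above1 below1 above2 below2.
exists (c1 + c2)%N, (D * (c1 + c2 + 3) + c1 + c2)%N; split=> [|p q]; first by nia.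
have [V1pq|nV1pq] := pselect (V1 (p, q)); last first.
  by constructor 1 => n le; apply: below1 nV1pq _; nia.
have [V2pq|nV2pq] := pselect (V2 (p, q)).
  constructor 3 => n le; apply: above2 V2pq _.
  have [D' eD'] : exists D', D = D'.+1 by exists D.-1; lia.
  by move: le; rewrite eD' /=; nia.
constructor 2 => n le; split; first by apply: below2 nV2pq _; nia.
by apply: above1 V1pq _; nia.
Qed.

(** Duplicator copies the answers given [P] levels below, until level [n1], where [same] applies, or
    until a pair of another kind, which [tri] decides. *)
Lemma frontier_shift_up (K n0 n1 P : nat) :
  (forall p q : ocn_Q N, [\/ frontier_above_band K n0 p q,
     frontier_in_band K n0 p q | frontier_below_band K n0 p q]) ->
  (n0 + K < n1)%N -> (0 < P)%N ->
  (forall (p q : ocn_Q N) (m : nat), (n1 <= m + K)%N -> (m <= n1 + K)%N ->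
     simulated (p, m) (q, n1) -> simulated (p, m + P)%N (q, n1 + P)%N) ->
  forall (p q : ocn_Q N) (m n : nat), frontier_in_band K n0 p q -> (n1 <= n)%N ->
    simulated (p, m) (q, n) -> simulated (p, m + P)%N (q, n + P)%N.
Proof.
move=> tri ltn1 P_gt0 same p q m n band len sim.
pose R (x y : ocn_Q N * nat) := exists m n : nat,
  [/\ frontier_in_band K n0 x.1 y.1, (n1 <= n)%N & (n <= m + K)%N] /\
  [/\ simulated (x.1, m) (y.1, n), (x.2 <= m + P)%N & y.2 = (n + P)%N].
have enter (p' q' : ocn_Q N) (m' m2 n' : nat) : frontier_in_band K n0 p' q' -> (n1 <= n')%N ->
    simulated (p', m') (q', n') -> (m2 <= m' + P)%N -> R (p', m2) (q', n' + P)%N.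
  move=> band' len' sim' le2; have [sim2 _] := band' n' ltac:(lia).
  (* Raising [m'] to the bottom of the band, which is simulated anyway, keeps it in the window of
     [same]. *)
  exists (maxn m' (n' - K)), n'; split; first by split=> //; lia.
  by split=> //=; [case: (leqP m' (n' - K)%N) | lia].
apply: (simulation_up_to (R := R)); last exact: enter (leqnn _).
move=> {p q m n band len sim} [p h] [q k] [m [n [[/= band len lem] [/= sim leh ->]]]] nsim.
have [_ top] := band n ltac:(lia).
have ltm : (m <= n + K)%N.
  by rewrite leqNgt; apply/negP => lt; apply: top; apply: simulated_mono sim; lia.
have ltn : (n1 < n)%N.
  rewrite ltn_neqAle len andbT; apply/eqP => eqn; apply: nsim; subst n.
  by apply: (@simulated_mono _ _ _ _ (m + P)%N _ (n1 + P)%N) => //; exact: same.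
split; first exact: (simulated_final sim).
move=> a [p' h'] [e [/= de eqh]]; have eb := delta_bound wfN de.
have st : ocn_step N (p, m) a (p', absz (m%:Z + e)) by exists e; split=> //=; lia.
have [[q' n'] [d [/= dd eqn]] sim'] := simulated_step sim st.
have db := delta_bound wfN dd.
exists (q', n' + P)%N; first by exists d; split=> //=; lia.
have [up|band'|down] := tri p' q'.
- by right; apply: simulated_mono (up (n' + P)%N _); lia.
- by left; apply: enter sim' _ => //; lia.
- by case: (down n'); [lia|apply: simulated_mono sim'; lia].
Qed.

Lemma frontier_shift_down (K n0 n1 P : nat) :
  (forall p q : ocn_Q N, [\/ frontier_above_band K n0 p q,
     frontier_in_band K n0 p q | frontier_below_band K n0 p q]) ->
  (n0 + K < n1)%N -> (0 < P)%N ->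
  (forall (p q : ocn_Q N) (m : nat), (n1 <= m + K)%N -> (m <= n1 + K)%N ->
     simulated (p, m + P)%N (q, n1 + P)%N -> simulated (p, m) (q, n1)) ->
  forall (p q : ocn_Q N) (m n : nat), frontier_in_band K n0 p q -> (n1 <= n)%N ->
    simulated (p, m + P)%N (q, n + P)%N -> simulated (p, m) (q, n).
Proof.
move=> tri ltn1 P_gt0 same p q m n band len sim.
pose R (x y : ocn_Q N * nat) := [/\ frontier_in_band K n0 x.1 y.1, (n1 <= y.2)%N &
  simulated (x.1, x.2 + P)%N (y.1, y.2 + P)%N].
apply: (simulation_up_to (R := R)); last by split.
move=> {p q m n band len sim} [p m] [q n] [/= band len sim] nsim.
have [bot _] := band n ltac:(lia); have [_ top] := band (n + P)%N ltac:(lia).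
have ltm : (m <= n + K)%N.
  by rewrite leqNgt; apply/negP => lt; apply: top; apply: simulated_mono sim; lia.
have gem : (n < m + K)%N.
  by rewrite ltnNge; apply/negP => le; apply: nsim; apply: simulated_mono bot; lia.
have ltn : (n1 < n)%N.
  rewrite ltn_neqAle len andbT; apply/eqP => eqn; apply: nsim; subst n.
  by apply: same sim; rewrite // ltnW.
split; first exact: (simulated_final sim).
move=> a [p' m'] [e [/= de eqm]]; have eb := delta_bound wfN de.
have st : ocn_step N (p, m + P)%N a (p', m' + P)%N by exists e; split=> //=; lia.
have [[q' k] [d [/= dd eqn]] sim'] := simulated_step sim st.
have db := delta_bound wfN dd.
have ek : k = (absz (n%:Z + d)%R + P)%N by lia.
rewrite {k}ek in eqn sim'; set n' := absz (n%:Z + d) in eqn sim'.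
exists (q', n'); first by exists d; split=> //=; lia.
have [up|band'|down] := tri p' q'.
- by right; apply: simulated_mono (up n' _); lia.
- by left; split=> //=; lia.
- by case: (down (n' + P)%N); [lia|apply: simulated_mono sim'; lia].
Qed.

Lemma finite_pigeonhole (T : finType) (f : nat -> T) (n0 : nat) :
  exists n1 n2 : nat, [/\ (n0 <= n1)%N, (n1 < n2)%N & f n1 = f n2].
Proof.
have /injectivePn[i [j neq eqf]] : ~~ injectiveb (fun i : 'I_#|T|.+1 => f (n0 + i)%N).
  by apply/negP => /injectiveP/leq_card; rewrite card_ord ltnn.
have [lt|gt|/val_inj eq] := ltngtP i j; last by rewrite eq eqxx in neq.
  by exists (n0 + i)%N, (n0 + j)%N; rewrite leq_addr ltn_add2l.
by exists (n0 + j)%N, (n0 + i)%N; rewrite leq_addr ltn_add2l.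
Qed.

(** Distance 2 is what two successors of one configuration can have. *)
Lemma near_diagonal_periodic : exists T P : nat, (0 < P)%N /\
  forall (p q : ocn_Q N) (m n : nat), (T <= n)%N -> (n <= m + 2)%N -> (m <= n + 2)%N ->
    simulated (p, m) (q, n) <-> simulated (p, m + P)%N (q, n + P)%N.
Proof.
have [K [n0 [leK tri]]] := diagonal_trichotomy.
pose f n := [ffun x : ocn_Q N * ocn_Q N * 'I_(2 * K).+1 =>
  `[< simulated (x.1.1, n + x.2 - K)%N (x.1.2, n) >]].
have [n1 [n2 [len1 ltn eqf]]] := finite_pigeonhole f (n0 + K).+1.
have same (p q : ocn_Q N) (m : nat) : (n1 <= m + K)%N -> (m <= n1 + K)%N ->
    simulated (p, m) (q, n1) <-> simulated (p, m + (n2 - n1))%N (q, n1 + (n2 - n1))%N.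
  move=> le1 le2; have ltm : (m + K - n1 < (2 * K).+1)%N by lia.
  have := congr1 (fun g : {ffun _ -> bool} => g (p, q, Ordinal ltm)) eqf; rewrite !ffunE /=.
  have -> : (n1 + (m + K - n1) - K = m)%N by lia.
  have -> : (n2 + (m + K - n1) - K = m + (n2 - n1))%N by lia.
  rewrite subnKC 1?ltnW // => eqb.
  by split=> /asboolP sim; apply/asboolP; [rewrite -eqb|rewrite eqb].
exists n1, (n2 - n1)%N; split=> [|p q m n len le1 le2]; first by lia.
have [up|band|down] := tri p q.
- split=> _; last by apply: simulated_mono (up n _); lia.
  by apply: simulated_mono (up (n + (n2 - n1))%N _); lia.
- split.
    by apply: (frontier_shift_up tri) band len => //; [lia|move=> p' q' m' h1 h2 /same; apply].
  by apply: (frontier_shift_down tri) band len => //; [lia|move=> p' q' m' h1 h2 /same; apply].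
- split=> sim; exfalso.
    by apply: (down n); [lia|apply: simulated_mono sim; lia].
  by apply: (down (n + (n2 - n1))%N); [lia|apply: simulated_mono sim; lia].
Qed.
End Periodicity.

Lemma ocn_run_rcons (Sigma : finType) (N : OCN Sigma) c w a c2 :
  ocn_run N c (rcons w a) c2 <-> exists2 c1, ocn_run N c w c1 & ocn_step N c1 a c2.
Proof.
split.
  elim: w c => [|b w IH] c /= r; inversion r; subst.
    by exists c; [constructor|inversion H4; subst].
  by have [c1 r1 st] := IH _ H4; exists c1 => //; econstructor; eauto.
case=> c1 r st; elim: r st => [c' st|c' b c'' v c3 st' _ IH st].
  by apply: ocn_run_cons st _; constructor.
by apply: ocn_run_cons st' (IH st).
Qed.

Lemma oca_run_rcons (Sigma : finType) (A : OCA Sigma) c w a c2 :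
  oca_run A c (rcons w a) c2 <-> exists2 c1, oca_run A c w c1 & oca_step A c1 a c2.
Proof.
split.
  elim: w c => [|b w IH] c /= r; inversion r; subst.
    by exists c; [constructor|inversion H4; subst].
  by have [c1 r1 st] := IH _ H4; exists c1 => //; econstructor; eauto.
case=> c1 r st; elim: r st => [c' st|c' b c'' v c3 st' _ IH st].
  by apply: oca_run_cons st _; constructor.
by apply: oca_run_cons st' (IH st).
Qed.

(** * Deterministic automaton for a periodic table of moves *)

Section PeriodicTable.
Variables (Sigma Q : finType) (q0 : Q) (F : {set Q}).
(* A move [(i, q)] goes to state [q] and adds [i - 1] to the counter. *)
Variable table : nat -> Q -> Sigma -> option ('I_3 * Q).
Hypothesis table_valid : forall n q a t, table n q a = Some t -> (0 < n + t.1)%N.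

Definition table_step (oc : option (Q * nat)) (a : Sigma) : option (Q * nat) :=
  if oc is Some c then omap (fun t : 'I_3 * Q => (t.2, (c.2 + t.1).-1)) (table c.2 c.1 a) else None.

Definition table_run (w : seq Sigma) : option (Q * nat) := foldl table_step (Some (q0, 0%N)) w.

Variables (T P' : nat).
Local Notation P := P'.+1.
Hypothesis table_periodic : forall n q a, (T <= n)%N -> table (n + P) q a = table n q a.

(* A multiple of the period, so that [threshold + n %% P] represents every [n >= threshold]. *)
Definition threshold : nat := (T * P)%N.

(** This part sits in the finite state; the automaton's counter holds the truncated [n - threshold],
    so its zero test decides [n <= threshold]. *)
Definition encode (n : nat) : 'I_threshold.+1 * 'I_P := (inord (minn n threshold), inord (n %% P)).

Definition representative (k : 'I_threshold.+1 * 'I_P) : nat :=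
  if (k.1 < threshold)%N then k.1 : nat else (threshold + k.2)%N.

Lemma table_representative n q a : table (representative (encode n)) q a = table n q a.
Proof.
have shift j m : (T <= m)%N -> table (m + j * P) q a = table m q a.
  move=> le; elim: j => [|j IH]; first by rewrite mul0n addn0.
  by rewrite mulSn (addnC P) addnA table_periodic ?IH //; lia.
rewrite /representative /encode /= inordK ?ltnS ?geq_minr //.
rewrite inordK ?ltn_mod //.
have [lt|ge] := ltnP n threshold; first by rewrite lt.
rewrite ltnn -(shift (n %/ P - T)%N); last by rewrite /threshold; nia.
congr (table _ q a); rewrite {3}(divn_eq n P).
have : (T <= n %/ P)%N by rewrite leq_divRL.
by move=> /subnK; rewrite /threshold => e; rewrite -{2}e; lia.
Qed.

(** Adding [P'] subtracts 1 modulo [P]. With a positive counter the value exceeds [threshold], and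
    one step cannot bring it below. *)
Definition next_code (k : 'I_threshold.+1 * 'I_P) (z : bool) (i : nat) : 'I_threshold.+1 * 'I_P :=
  (inord (if z then minn (k.1 + i).-1 threshold else threshold), inord ((k.2 + i + P') %% P)).

Definition counter_update (k : 'I_threshold.+1 * 'I_P) (z : bool) (i : nat) : int :=
  if z then ((k.1 == threshold :> nat) && (i == 2))%:Z else i%:Z - 1.

Lemma next_codeP n i : (0 < n + i)%N -> (i < 3)%N ->
  next_code (encode n) (n - threshold == 0)%N i = encode (n + i).-1.
Proof.
move=> pos lti; rewrite /next_code /encode /= inordK ?ltnS ?geq_minr // inordK ?ltn_mod //.
congr (inord _, inord _).
  by case: ifP; lia.
rewrite -addnA modnDml addnA; have -> : (n + i + P' = (n + i).-1 + P)%N by lia.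
by rewrite modnDr.
Qed.

Lemma counter_updateP n i : (0 < n + i)%N -> (i < 3)%N ->
  (n - threshold)%:Z + counter_update (encode n) (n - threshold == 0)%N i =
  ((n + i).-1 - threshold)%:Z.
Proof.
move=> pos lti; rewrite /counter_update /encode /= inordK ?ltnS ?geq_minr //.
by case: ifP; lia.
Qed.

Definition table_oca : OCA Sigma := {|
  oca_Q := (Q * ('I_threshold.+1 * 'I_P))%type;
  oca_delta := fun s z a d s' =>
    if table (representative s.2) s.1 a is Some t then
      (d == counter_update s.2 z t.1) && (s' == (t.2, next_code s.2 z t.1))
    else false;
  oca_q0 := (q0, encode 0);
  oca_F := [set s | s.1 \in F] |}.

Lemma table_oca_wf : OCA_wf table_oca.
Proof.
move=> q z a d p /=; case: table => // -[[i lti] q'] /andP[/eqP-> _].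
by rewrite /counter_update /is_update /=; case: z => /=; [case: andb|split=> //; lia].
Qed.

Lemma table_oca_deterministic : OCA_deterministic table_oca.
Proof.
move=> q z a d p d' p' /=; case: table => // t /andP[/eqP-> /eqP->] /andP[/eqP-> /eqP->].
by [].
Qed.

Lemma table_oca_step q n a c : oca_step table_oca ((q, encode n), n - threshold)%N a c <->
  exists2 t, table n q a = Some t &
    c = ((t.2, encode (n + t.1).-1), (n + t.1).-1 - threshold)%N.
Proof.
split.
  case=> d [] /=; rewrite table_representative.
  case E: (table n q a) => [t|] // /andP[/eqP-> /eqP e1] e2; exists t => //.
  have pos := table_valid E; have lti := ltn_ord t.1.
  rewrite next_codeP // in e1; rewrite counter_updateP // in e2.
  by case: c e1 e2 => s k /= -> [->].
case=> t E ->; have pos := table_valid E; have lti := ltn_ord t.1.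
exists (counter_update (encode n) (n - threshold == 0)%N t.1); split=> /=.
  by rewrite table_representative E next_codeP // !eqxx.
exact: counter_updateP.
Qed.

Lemma table_oca_run w c : oca_run table_oca (oca_q0 table_oca, 0%N) w c <->
  exists2 c', table_run w = Some c' & c = ((c'.1, encode c'.2), c'.2 - threshold)%N.
Proof.
elim/last_ind: w c => [|w a IH] c.
  split=> [r|[_ [<-] ->]]; last exact: oca_run_nil.
  by exists (q0, 0%N) => //; inversion r.
rewrite oca_run_rcons /table_run foldl_rcons -/(table_run w); split.
  case=> c1 /IH[[q n] -> ->] /table_oca_step[t E ->] /=.
  by rewrite E /=; exists (t.2, (n + t.1).-1).
case; case E: (table_run w) => [[q n]|] //= c'; case E': (table n q a) => [t|] //= -[<-] ->.
exists ((q, encode n), n - threshold)%N; first by apply/IH; exists (q, n).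
by apply/table_oca_step; exists t.
Qed.

Lemma table_oca_lang w : oca_lang table_oca w <->
  exists2 c, table_run w = Some c & c.1 \in F.
Proof.
split; first by case=> _ [/table_oca_run[c E ->]]; rewrite /= inE; exists c.
case=> c E cF; exists ((c.1, encode c.2), c.2 - threshold)%N; rewrite /= inE; split=> //.
by apply/table_oca_run; exists c.
Qed.
End PeriodicTable.

(** * Following dominating successors *)

Section Determinisation.
Variables (Sigma : finType) (N : OCN Sigma).
Hypothesis wfN : OCN_wf N.
Local Notation reach := (ocn_run N (ocn_q0 N, 0%N)).

Definition dominating (w : seq Sigma) (c : ocn_Q N * nat) : Prop :=
  reach w c /\ forall c', reach w c' -> simulated c' c.

Hypothesis dominating_exists : forall w, exists c, dominating w c.

Definition dominating_move (n : nat) (q : ocn_Q N) (a : Sigma) (t : 'I_3 * ocn_Q N) : Prop :=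
  [/\ (0 < n + t.1)%N, ocn_delta N q a (t.1%:Z - 1) t.2 &
      forall c, ocn_step N (q, n) a c -> simulated c (t.2, (n + t.1).-1)].

Definition resolver (n : nat) (q : ocn_Q N) (a : Sigma) : option ('I_3 * ocn_Q N) :=
  [pick t | `[< dominating_move n q a t >]].

Lemma resolver_some n q a t : resolver n q a = Some t -> dominating_move n q a t.
Proof. by rewrite /resolver; case: pickP => // x /asboolP dom [<-]. Qed.

(** [dominating_move] compares successors of one configuration, which are near the diagonal, so it
    is periodic, and equal predicates have equal picks. [T.+1] allows for a decrement. *)
Lemma resolver_periodic : exists T P', forall n q a, (T <= n)%N ->
  resolver (n + P'.+1) q a = resolver n q a.
Proof.
have [T [[|P'] [// _ per]]] := near_diagonal_periodic wfN.
exists T.+1, P' => n q a lt; apply: eq_pick => -[i q'] /=.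
apply: asbool_equiv_eq; have lti := ltn_ord i.
have e : ((n + P'.+1 + i).-1 = (n + i).-1 + P'.+1)%N by lia.
split=> -[/= pos dl dom]; split=> //=; try lia; move=> [p m] [d [/= dd eqm]];
  have db := delta_bound wfN dd.
  have : simulated (p, m + P'.+1)%N (q', (n + P'.+1 + i).-1).
    by apply: dom; exists d; split=> //=; lia.
  by rewrite e -per //; lia.
have em : m = (absz (n%:Z + d)%R + P'.+1)%N by lia.
rewrite e em -per; try lia.
by apply: dom; exists d; split=> //=; lia.
Qed.

Lemma dominating_move_step n q a t :
  dominating_move n q a t -> ocn_step N (q, n) a (t.2, (n + t.1).-1).
Proof. by case=> pos dl _; exists (t.1%:Z - 1); split=> //=; lia. Qed.

(** A configuration dominating [rcons w a] has a predecessor simulated by [(q, n)]; the matching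
    answer from [(q, n)] dominates too. Whatever [resolver] picks simulates that answer. *)
Lemma resolver_dominating w a q n : dominating w (q, n) ->
  exists2 t, resolver n q a = Some t & dominating (rcons w a) (t.2, (n + t.1).-1).
Proof.
move=> [rqn dqn]; have [c [/ocn_run_rcons[c1 r1 st1] domc]] := dominating_exists (rcons w a).
have [[q' n'] [d [/= dl eqn]] sim] := simulated_step (dqn _ r1) st1.
have db := delta_bound wfN dl.
have lti : (absz (d + 1)%R < 3)%N by lia.
have exdom : dominating_move n q a (Ordinal lti, q').
  split=> /=; first by lia.
    by have -> : (absz (d + 1))%:Z - 1 = d by lia.
  move=> c2 st2; have -> : (n + absz (d + 1)%R).-1 = n' by lia.
  by apply: simulated_trans sim; apply: domc; apply/ocn_run_rcons; exists (q, n).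
case E: (resolver n q a) => [t|]; last first.
  move: E; rewrite /resolver; case: pickP => // /(_ (Ordinal lti, q')) /asboolP; tauto.
exists t => //; have dom := resolver_some E; split.
  by apply/ocn_run_rcons; exists (q, n) => //; exact: dominating_move_step.
move=> c2 /ocn_run_rcons r2; case: dom => _ _; move/(_ (q', n')) => simt.
apply: simulated_trans (domc c2 _) _; first exact/ocn_run_rcons.
by apply: simulated_trans sim _; apply: simt; exists d.
Qed.

Lemma resolver_run_dominating w :
  exists2 c, table_run (ocn_q0 N) resolver w = Some c & dominating w c.
Proof.
elim/last_ind: w => [|w a [[q n] E dom]].
  exists (ocn_q0 N, 0%N) => //; split; first exact: ocn_run_nil.
  by move=> c r; inversion r; exact: simulated_refl.
have [t Et domt] := resolver_dominating a dom.
by exists (t.2, (n + t.1).-1) => //; rewrite /table_run foldl_rcons -/(table_run _ _ w) E /= Et.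
Qed.

Lemma determinisation : exists D : OCA Sigma,
  OCA_wf D /\ OCA_deterministic D /\ (forall w, oca_lang D w <-> ocn_lang N w).
Proof.
have [T [P' per]] := resolver_periodic.
exists (table_oca (ocn_q0 N) (ocn_F N) resolver T P'); split; first exact: table_oca_wf.
split=> [|w]; first exact: table_oca_deterministic.
have valid n q a t : resolver n q a = Some t -> (0 < n + t.1)%N by case/resolver_some.
rewrite table_oca_lang //; have [c E [rc domc]] := resolver_run_dominating w.
split=> [[c' E' cF]|[c' [rc' c'F]]].
  by exists c'; move: E' cF; rewrite E => -[<-].
by exists c => //; apply: simulated_final c'F; exact: domc.
Qed.
End Determinisation.

(** * Completion by a sink, and Eve's strategy *)

Section Completion.
Variables (Sigma : finType) (N : OCN Sigma).

(** The sink gives every word a run, as [dominating_exists] requires, and receives Eve's play once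
    it is stuck. *)
Definition completion : OCN Sigma := {|
  ocn_Q := option (ocn_Q N);
  ocn_delta := fun q a d p =>
    match q, p with
    | Some q, Some p => ocn_delta N q a d p
    | _, None => d == 0
    | None, Some _ => false
    end;
  ocn_q0 := Some (ocn_q0 N);
  ocn_F := [set q | if q is Some q' then q' \in ocn_F N else false] |}.

Lemma completion_wf : OCN_wf N -> OCN_wf completion.
Proof.
move=> wfN [q|] a d [p|] //=; first exact: wfN.
all: by move/eqP->.
Qed.

Lemma completion_run w q n : ocn_run completion (ocn_q0 completion, 0%N) w (Some q, n) <->
  ocn_run N (ocn_q0 N, 0%N) w (q, n).
Proof.
elim/last_ind: w q n => [|w a IH] q n.
  by split=> r; inversion r; constructor.
split=> /ocn_run_rcons[[q1 n1] r st]; apply/ocn_run_rcons.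
  case: q1 r st => [q1|] r [d [/= dl eqn]] //.
  by exists (q1, n1); [exact/IH|exists d].
by exists (Some q1, n1); [exact/IH|case: st => d [/= dl eqn]; exists d].
Qed.

Lemma completion_lang w : ocn_lang completion w <-> ocn_lang N w.
Proof.
split=> -[[q n] [r qF]]; last first.
  by exists (Some q, n); split; [exact/completion_run|rewrite /= inE].
case: q r qF => [q|] r; rewrite /= inE // => qF.
by exists (q, n); split=> //; exact/completion_run.
Qed.

Variable sigma : eve_strategy N.

Lemma play_rcons w a : play sigma (rcons w a) =
  if play sigma w is Some c then apply_move c a (sigma w a) else None.
Proof.
rewrite /play -[in sigma w a](cat0s w).
elim: w [::] (Some _) => [|b w IH] h oc /=; first by rewrite cats0.
by rewrite IH cat_rcons.
Qed.

Hypothesis sigma_wins : eve_winning sigma.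

Lemma winning_play_lang w : ocn_lang N w -> exists2 c, play sigma w = Some c & c.1 \in ocn_F N.
Proof.
have prefix_play v : is_prefix_of_lang (ocn_lang N) v -> exists c, play sigma v = Some c.
  elim/last_ind: v => [|v a IH] [u Lu]; first by exists (ocn_q0 N, 0%N).
  have [|c E] := IH; first by exists (a :: u); rewrite -cat_rcons.
  have [valid _] := sigma_wins E (ex_intro _ u Lu).
  by rewrite play_rcons E /apply_move valid; eexists.
move=> Lw; have pre v : ocn_lang N v -> is_prefix_of_lang (ocn_lang N) v.
  by exists [::]; rewrite cats0.
case/lastP: w Lw => [|w a] Lw.
  by case: Lw => c [r cF]; inversion r; subst; exists (ocn_q0 N, 0%N).
have [|c E] := prefix_play w; first by exists [:: a]; rewrite cats1.
have [valid final] := sigma_wins E (pre _ Lw).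
by rewrite play_rcons E /apply_move valid; eexists; [reflexivity|exact: final].
Qed.

Definition follows_play (w : seq Sigma) (c : ocn_Q completion * nat) : Prop :=
  ocn_run completion (ocn_q0 completion, 0%N) w c /\
  if c.1 is Some q then play sigma w = Some (q, c.2) else play sigma w = None.

Lemma follows_play_step w a c : follows_play w c ->
  exists2 c', ocn_step completion c a c' & follows_play (rcons w a) c'.
Proof.
case: c => q n [r E].
suff [c' st E'] : exists2 c', ocn_step completion (q, n) a c' &
    if c'.1 is Some q' then play sigma (rcons w a) = Some (q', c'.2)
    else play sigma (rcons w a) = None.
  by exists c' => //; split=> //; apply/ocn_run_rcons; exists (q, n).
case: q r E => [q|] r /= E; last first.
  by exists (None, n); [exists 0; rewrite addr0|rewrite /= play_rcons E].
rewrite play_rcons E /apply_move; case: ifP => [/andP[/= dl pos]|_].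
  by exists (Some (sigma w a).2, absz (n%:Z + (sigma w a).1)) => //; exists (sigma w a).1;
    split=> //=; lia.
by exists (None, n) => //; exists 0; rewrite addr0.
Qed.

Lemma follows_play_total w : exists c, follows_play w c.
Proof.
elim/last_ind: w => [|w a [c /(follows_play_step a)[c' _ f]]]; last by exists c'.
by exists (Some (ocn_q0 N), 0%N); split; first exact: ocn_run_nil.
Qed.

(** Relating the ends of arbitrary runs to Eve's play on the same word is a simulation: a final
    state of the run puts the word in the language, so Eve's state is final too. *)
Lemma follows_play_dominating w c c' : follows_play w c ->
  ocn_run completion (ocn_q0 completion, 0%N) w c' -> simulated c' c.
Proof.
move=> fc rc'; exists (fun c' c => exists2 w, follows_play w c &
  ocn_run completion (ocn_q0 completion, 0%N) w c'); last by exists w.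
move=> {w fc rc'}{}c' {}c [w fc rc']; split=> [c'F|a c1 st].
  have /completion_lang/winning_play_lang[[q n] E qF] : ocn_lang completion w by exists c'.
  case: c fc => -[q'|] k [_ /=]; last by rewrite E.
  by rewrite E inE => -[<- _].
have [c1' st' f'] := follows_play_step a fc; exists c1' => //.
by exists (rcons w a) => //; apply/ocn_run_rcons; exists c'.
Qed.
End Completion.

Theorem theorem3 (Sigma : finType) (N : OCN Sigma) :
  OCN_wf N -> history_deterministic N ->
  exists D : OCA Sigma,
    OCA_wf D /\ OCA_deterministic D /\
    (forall w : seq Sigma, oca_lang D w <-> ocn_lang N w).
Proof.
move=> wfN [sigma wins].
have [w|D [wfD [detD langD]]] := @determinisation _ (completion N) (completion_wf wfN).
  have [c f] := follows_play_total sigma w; exists c; split; first by case: f.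
  by move=> c' r; exact: (follows_play_dominating wins f r).
by exists D; split=> //; split=> // w; rewrite langD; exact: completion_lang.
Qed.
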